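(* Let $k\ge 0$ be an integer and let $S_k\oplus \boldsymbol{x}_{k+1}=[\boldsymbol{x}_1,y_1,\ldots,\boldsymbol{x}_k,y_k,\boldsymbol{x}_{k+1}]$ be any observed sequence with $\boldsymbol{x}_i\in\mathbb{R}^d$, $y_i\in\mathbb{R}$. Under the pretraining data model described in the context, the posterior density of the task $(\boldsymbol{\mu},\boldsymbol{w})$ given the observation $S_k\oplus \boldsymbol{x}_{k+1}$ is the Gaussian mixture $$P(\boldsymbol{\mu},\boldsymbol{w}\mid S_k\oplus \boldsymbol{x}_{k+1})=\sum_{m=1}^M\tilde\pi_m\,\mathcal{N}(\boldsymbol{\mu}\mid\tilde{\boldsymbol{\mu}}_m,\tilde{\boldsymbol\Sigma}_\mu)\,\mathcal{N}(\boldsymbol{w}\mid\tilde{\boldsymbol{w}}_m,\tilde{\boldsymbol\Sigma}_w),$$ where, with $\delta_\mu=\sigma_\mu^2/\sigma_x^2$, $\delta_w=\sigma_w^2/\sigma_y^2$, $\bar{\boldsymbol\Sigma}_\mu=\boldsymbol{I}$, $\bar{\boldsymbol\mu}=\frac{1}{k+1}\sum_{i=1}^{k+1}\boldsymbol{x}_i$, $\bar{\boldsymbol\Sigma}_w=\frac1k\sum_{i=1}^k\boldsymbol{x}_i\boldsymbol{x}_i^\top$, $\bar{\boldsymbol{w}}=\frac1k\sum_{i=1}^k\boldsymbol{x}_iy_i$ (for $k=0$, $k\bar{\boldsymbol\Sigma}_w$ and $k\bar{\boldsymbol w}$ are read as $0$): $$\tilde{\boldsymbol\mu}_m=(\boldsymbol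 I+(k+1)\delta_\mu\bar{\boldsymbol\Sigma}_\mu)^{-1}(\boldsymbol\mu_m+(k+1)\delta_\mu\bar{\boldsymbol\mu}),\qquad \tilde{\boldsymbol w}_m=(\boldsymbol I+k\delta_w\bar{\boldsymbol\Sigma}_w)^{-1}(\boldsymbol w_m+k\delta_w\bar{\boldsymbol w}),$$ $$\tilde{\boldsymbol\Sigma}_\mu=\sigma_\mu^2(\boldsymbol I+(k+1)\delta_\mu\bar{\boldsymbol\Sigma}_\mu)^{-1},\qquad \tilde{\boldsymbol\Sigma}_w=\sigma_w^2(\boldsymbol I+k\delta_w\bar{\boldsymbol\Sigma}_w)^{-1},$$ $$\tilde\pi_m=\pi_m C_1c_m^{\mu}c_m^{w},$$ $$c_m^{\mu}=\exp\left(-\frac{\|\boldsymbol\mu_m\|^2-\|\boldsymbol\mu_m+(k+1)\delta_\mu\bar{\boldsymbol\mu}\|^2_{(\boldsymbol I+(k+1)\delta_\mu\bar{\boldsymbol\Sigma}_\mu)^{-1}}}{2\sigma_\mu^2}\right),$$ $$c_m^{w}=\exp\left(-\frac{\|\boldsymbol w_m\|^2-\|\boldsymbol w_m+k\delta_w\bar{\boldsymbol w}\|^2_{(\boldsymbol I+k\delta_w\bar{\boldsymbol\Sigma}_w)^{-1}}}{2\sigma_w^2}\right),$$ and $C_1$ is the normalizing constant (independent of $m$) for which $\sum_{m=1}^M\tilde\pi_m=1$.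
   Context: $\mathcal{N}(\cdot\mid \boldsymbol a,\boldsymbol\Sigma)$ is the Gaussian density with mean $\boldsymbol a$ and covariance $\boldsymbol\Sigma$; $\|\boldsymbol v\|^2=\boldsymbol v^\top\boldsymbol v$ and $\|\boldsymbol v\|_{\boldsymbol A}^2=\boldsymbol v^\top\boldsymbol A\boldsymbol v$. Pretraining data model. Fix $d,M\ge1$ and $\sigma_\mu,\sigma_w,\sigma_x,\sigma_y>0$. A task is a pair $(\boldsymbol\mu,\boldsymbol w)\in\mathbb{R}^d\times\mathbb{R}^d$ drawn from the prior density $P(\boldsymbol\mu,\boldsymbol w)=\sum_{m=1}^M\pi_m\mathcal N(\boldsymbol\mu\mid\boldsymbol\mu_m,\sigma_\mu^2\boldsymbol I)\mathcal N(\boldsymbol w\mid\boldsymbol w_m,\sigma_w^2\boldsymbol I)$, where $0<\pi_m<1$, $\sum_m\pi_m=1$, $\|\boldsymbol\mu_m\|=\|\boldsymbol w_m\|=1$ for all $m$, and there is $r>1$ with $1/r\le\pi_\alpha/\pi_\beta\le r$ for all $\alpha,\beta$. Given the task, the pairs $(\boldsymbol x_i,y_i)$ are i.i.d. with $\boldsymbol x_i\sim\mathcal N(\boldsymbol\mu,\sigma_x^2\boldsymbol I)$ and $y_i\mid\boldsymbol x_i\sim\mathcal N(\boldsymbol w^\top\boldsymbol x_i,\sigma_y^2)$. In $S_k\oplus\boldsymbol x_{k+1}$ the first $k$ inputs are observed with their labels and $\boldsymbol x_{k+1}$ without its label. *)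

(* Defs.v *)
From HB Require Import structures.
From mathcomp Require Import all_boot all_order all_algebra.
From mathcomp Require Import all_classical all_reals all_analysis.
Set Implicit Arguments.
Unset Strict Implicit.
Unset Printing Implicit Defensive.
Import Order.TTheory GRing.Theory Num.Theory.
Import numFieldNormedType.Exports.
Local Open Scope classical_set_scope.
Local Open Scope ring_scope.

Section lebesgue_cons.
Context (R : realType) (n : nat).
Local Notation RT := (measurableTypeR R).
Variable m : {sigma_finite_measure set (n.-tuple RT) -> \bar R}.

Definition tuple_cons (p : RT * n.-tuple RT) : n.+1.-tuple RT :=
  [the n.+1.-tuple RT of p.1 :: p.2].

Lemma measurable_tuple_cons : measurable_fun [set: RT * n.-tuple RT] tuple_cons.
Proof. exact: measurable_cons. Qed.

Definition lebesgue_cons : set (n.+1.-tuple RT) -> \bar R :=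
  pushforward (@lebesgue_measure R \x m)%E tuple_cons.

Let measurable_pre A : measurable A -> measurable (tuple_cons @^-1` A).
Proof.
by move=> mA; rewrite -[_ @^-1` _]setTI; exact: measurable_tuple_cons.
Qed.

Let lebesgue_cons0 : lebesgue_cons set0 = 0%E.
Proof. by rewrite /lebesgue_cons/pushforward preimage_set0 measure0. Qed.

Let lebesgue_cons_ge0 A : (0 <= lebesgue_cons A)%E.
Proof. by rewrite /lebesgue_cons/pushforward; exact: measure_ge0. Qed.

Let lebesgue_cons_sigma_additive : semi_sigma_additive lebesgue_cons.
Proof.
move=> F mF tF mUF; rewrite /lebesgue_cons/pushforward preimage_bigcup.
apply: measure_semi_sigma_additive.
- by move=> i; exact: measurable_pre.
- apply/trivIsetP => /= i j _ _ ij; rewrite -preimage_setI.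
  by move/trivIsetP : tF => /(_ _ _ _ _ ij) ->//; rewrite preimage_set0.
- by rewrite -preimage_bigcup; exact: measurable_pre.
Qed.

HB.instance Definition _ := isMeasure.Build _ _ _
  lebesgue_cons lebesgue_cons0 lebesgue_cons_ge0 lebesgue_cons_sigma_additive.

Let lebesgue_cons_sigma_finite : sigma_finite setT lebesgue_cons.
Proof.
have /sigma_finiteP[F [FT ndF Foo]] := sigma_finiteT (@lebesgue_measure R).
have /sigma_finiteP[G [GT ndG Goo]] := sigma_finiteT m.
pose u (t : n.+1.-tuple RT) : RT * n.-tuple RT :=
  (thead t, [tuple of behead t]).
have mu : measurable_fun setT u.
  apply/measurable_fun_pairP; split; first exact: measurable_tnth.
  exact: measurable_behead.
have uK : cancel tuple_cons u.
  by case=> a t; congr pair; apply: val_inj.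
exists (fun i => u @^-1` (F i `*` G i)).
  rewrite -preimage_bigcup; apply/seteqP; split=> // t _ /=.
  have [i _ Fi] : (\bigcup_i F i) (u t).1 by rewrite -FT.
  have [j _ Gj] : (\bigcup_i G i) (u t).2 by rewrite -GT.
  exists (maxn i j) => //; split.
  - exact: (subsetPset _ _ (ndF _ _ (leq_maxl i j))).
  - exact: (subsetPset _ _ (ndG _ _ (leq_maxr i j))).
move=> i; have [mF Fi] := Foo i; have [mG Gi] := Goo i; split.
  by rewrite -[_ @^-1` _]setTI; apply: mu => //; exact: measurableX.
rewrite /lebesgue_cons/pushforward -comp_preimage.
rewrite (_ : u \o tuple_cons = id); last by apply/funext => p /=; rewrite uK.
by rewrite preimage_id product_measure1E// lte_mul_pinfty// ge0_fin_numE.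
Qed.

HB.instance Definition _ := Measure_isSigmaFinite.Build _ _ _
  lebesgue_cons lebesgue_cons_sigma_finite.

End lebesgue_cons.

(* Lebesgue measure on R^n, for the product sigma-algebra on n.-tuple R. *)
Fixpoint lebesgue_tuple (R : realType) (n : nat) :
    {sigma_finite_measure set (n.-tuple (measurableTypeR R)) -> \bar R} :=
  match n with
  | 0 => [the {sigma_finite_measure set _ -> \bar R} of
            dirac ([tuple] : 0.-tuple (measurableTypeR R))]
  | n'.+1 => [the {sigma_finite_measure set _ -> \bar R} of
            lebesgue_cons (lebesgue_tuple R n')]
  end.

Section gaussian.
Context (R : realType) (d : nat).
Implicit Types (v a : 'cV[R]_d) (A S : 'M[R]_d).

Definition sqnorm_mx A v : R := (v^T *m A *m v) 0 0.

Definition sqnorm v : R := (v^T *m v) 0 0.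

(* The norm `|v| of the library on matrices is the sup norm. *)
Definition l2norm v : R := Num.sqrt (sqnorm v).

(* Density at v of N(a, S), for S symmetric positive definite. *)
Definition gaussian_pdf a S v : R :=
  (Num.sqrt (\det ((2 * pi) *: S)))^-1 *
  expR (- sqnorm_mx (invmx S) (v - a) / 2).

End gaussian.

Section pretraining_model.
Context (R : realType) (d M : nat).
Variables (wt : 'I_M -> R) (mu_ w_ : 'I_M -> 'cV[R]_d) (smu sw sx sy : R).

Definition prior_pdf (mu w : 'cV[R]_d) : R :=
  \sum_(m < M) wt m * gaussian_pdf (mu_ m) (smu ^+ 2)%:M mu
                    * gaussian_pdf (w_ m) (sw ^+ 2)%:M w.

Variables (k : nat) (x : 'I_k.+1 -> 'cV[R]_d) (y : 'I_k -> R).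

(* The inputs x_1, ..., x_k that come with a label. *)
Definition labeled (i : 'I_k) : 'cV[R]_d := x (widen_ord (leqnSn k) i).

(* Conditional density of the observation [x_1, y_1, ..., x_k, y_k, x_(k+1)]
   given the task; the second argument of normal_pdf is a standard deviation. *)
Definition likelihood (mu w : 'cV[R]_d) : R :=
  (\prod_(i < k) (gaussian_pdf mu (sx ^+ 2)%:M (labeled i) *
                  normal_pdf ((w^T *m labeled i) 0 0) sy (y i))) *
  gaussian_pdf mu (sx ^+ 2)%:M (x ord_max).

Definition joint_pdf (mu w : 'cV[R]_d) : R := prior_pdf mu w * likelihood mu w.

Definition col_of_tuple (t : d.-tuple (measurableTypeR R)) : 'cV[R]_d :=
  \col_i tnth t i.

(* Marginal density of the observation. *)
Definition evidence : R :=
  \int[(lebesgue_tuple R d \x lebesgue_tuple R d)%E]_t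
    joint_pdf (col_of_tuple t.1) (col_of_tuple t.2).

Definition posterior_pdf (mu w : 'cV[R]_d) : R := joint_pdf mu w / evidence.

End pretraining_model.

(* Main.v *)
Require Import Defs.
From HB Require Import structures.
From mathcomp Require Import all_boot all_order all_algebra.
From mathcomp Require Import all_classical all_reals all_analysis.
From mathcomp Require Import measurable_realfun ring.
Import Order.TTheory GRing.Theory Num.Theory.
Import numFieldNormedType.Exports.
Local Open Scope ring_scope.

(** As a function of the task, the likelihood is, up to a positive constant, a
    product of an exponential of a quadratic polynomial in [mu] and one in [w].
    Completing the square against the m-th prior component turns the joint
    density into [K * \sum_m wt m * cmu m * cw m * N(mu) * N(w)] with [K]
    independent of [m]. The evidence is therefore
    [K * \sum_m wt m * cmu m * cw m], because a Gaussian density of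
    arbitrary positive definite precision has integral 1: integrate out the
    first coordinate, which leaves the Gaussian density whose precision is the
    Schur complement. *)

(** * Quadratic forms, Schur complements and positive definiteness *)

Section quadratic_forms.
Context {R : realType}.

Lemma entry_addmx m n (A B : 'M[R]_(m, n)) i j : (A + B) i j = A i j + B i j.
Proof. exact: mxE. Qed.

Lemma entry_oppmx m n (A : 'M[R]_(m, n)) i j : (- A) i j = - A i j.
Proof. exact: mxE. Qed.

Lemma entry_scalemx m n c (A : 'M[R]_(m, n)) i j : (c *: A) i j = c * A i j.
Proof. exact: mxE. Qed.

(** Symmetry is part of the notion, since over the reals positivity of the form does not imply it
    and the block formulas below rely on it. *)
Definition pos_def {n} (A : 'M[R]_n) :=
  A^T = A /\ forall v, v != 0 -> 0 < sqnorm_mx A v.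

Lemma sqnorm_mxD n (A : 'M[R]_n) u v : A^T = A ->
  sqnorm_mx A (u + v) =
  sqnorm_mx A u + 2 * (u^T *m A *m v) 0 0 + sqnorm_mx A v.
Proof.
move=> sA; have vu : u^T *m A *m v = (v^T *m A *m u)^T.
  by rewrite !trmx_mul trmxK sA mulmxA.
rewrite mulr_natl mulr2n {2}vu [_^T 0 0]mxE.
by rewrite /sqnorm_mx [(u + v)^T]linearD/= !mulmxDl !mulmxDr !mxE !addrA.
Qed.

Lemma sqnorm_mxZ n (A : 'M[R]_n) c v :
  sqnorm_mx (c *: A) v = c * sqnorm_mx A v.
Proof. by rewrite /sqnorm_mx -scalemxAr -scalemxAl mxE. Qed.

Lemma sqnorm_mxDl n (A B : 'M[R]_n) v :
  sqnorm_mx (A + B) v = sqnorm_mx A v + sqnorm_mx B v.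
Proof. by rewrite /sqnorm_mx mulmxDr mulmxDl mxE. Qed.

Lemma sqnorm_mx1 n (v : 'cV[R]_n) : sqnorm_mx 1%:M v = sqnorm v.
Proof. by rewrite /sqnorm_mx mulmx1. Qed.

Lemma sqnormE n (v : 'cV[R]_n) : sqnorm v = \sum_i v i 0 ^+ 2.
Proof. by rewrite /sqnorm mxE; apply: eq_bigr => i _; rewrite mxE expr2. Qed.

Lemma sqnormN n (v : 'cV[R]_n) : sqnorm (- v) = sqnorm v.
Proof. by rewrite !sqnormE; apply: eq_bigr => i _; rewrite mxE sqrrN. Qed.

Lemma sqnorm_gt0 n (v : 'cV[R]_n) : v != 0 -> 0 < sqnorm v.
Proof.
move=> v0; rewrite sqnormE lt_def sumr_ge0 ?andbT; last first.
  by move=> i _; exact: sqr_ge0.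
apply: contra v0 => /eqP/psumr_eq0P h.
apply/eqP/colP => i; rewrite mxE; apply/eqP; rewrite -sqrf_eq0.
by rewrite h// => j _; exact: sqr_ge0.
Qed.

(* [A = [[alpha, b], [b^T, D]]] has Schur complement [D - b^T b / alpha]. *)
Definition schur n (A : 'M[R]_(1 + n)) : 'M[R]_n :=
  drsubmx A - (A 0 0)^-1 *: ((ursubmx A)^T *m ursubmx A).

Lemma sym_block n (A : 'M[R]_(1 + n)) : A^T = A ->
  A = block_mx (A 0 0)%:M (ursubmx A) (ursubmx A)^T (drsubmx A).
Proof.
move=> sA; rewrite -[LHS]submxK; congr block_mx.
  by rewrite [LHS]mx11_scalar !mxE; congr (A _ _)%:M; exact: val_inj.
by rewrite trmx_ursub sA.
Qed.

(** One step of block Gaussian elimination: a unit lower triangular factor times a block upper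
    triangular one whose diagonal blocks are the pivot and the Schur complement. *)
Lemma det_schur n (A : 'M[R]_(1 + n)) : A^T = A -> A 0 0 != 0 ->
  \det A = A 0 0 * \det (schur n A).
Proof.
move=> sA a0; rewrite {1}(sym_block _ _ sA).
have -> : block_mx (A 0 0)%:M (ursubmx A) (ursubmx A)^T (drsubmx A) =
  block_mx 1%:M 0 ((A 0 0)^-1 *: (ursubmx A)^T) 1%:M *m
  block_mx (A 0 0)%:M (ursubmx A) 0 (schur n A).
  rewrite mulmx_block !mul1mx !mul0mx ?mulmx0 !addr0 mul_mx_scalar scalerA.
  by rewrite divff// scale1r -scalemxAl addrC subrK.
by rewrite det_mulmx det_lblock det_ublock !det1 !mul1r det_scalar1.
Qed.

(** Completing the square in the first coordinate [s] alone; what remains is the Schur complement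
    form. *)
Lemma sqnorm_mx_schur n (A : 'M[R]_(1 + n)) (s : R) (u : 'cV[R]_n) :
  A^T = A -> A 0 0 != 0 ->
  sqnorm_mx A (col_mx s%:M u) =
  A 0 0 * (s + (A 0 0)^-1 * (ursubmx A *m u) 0 0) ^+ 2 +
  sqnorm_mx (schur n A) u.
Proof.
move=> sA a0; rewrite {1}(sym_block _ _ sA) /sqnorm_mx tr_col_mx mul_row_block.
rewrite mul_row_col !mulmxDl tr_scalar_mx /schur mulmxBr mulmxBl.
rewrite -scalemxAr -scalemxAl.
move: (ursubmx A) (drsubmx A) => b D; set p : R := (b *m u) 0 0.
have bu : b *m u = p%:M by exact: mx11_scalar.
have ub : u^T *m b^T = p%:M by rewrite -trmx_mul bu tr_scalar_mx.
rewrite mulmxA ub -(mulmxA s%:M b) -(mulmxA p%:M b) bu -!scalar_mxM.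
have e11 (c : R) : (c%:M : 'M[R]_1) 0 0 = c by rewrite mxE eqxx mulr1n.
rewrite !entry_addmx entry_oppmx entry_scalemx !e11.
by field.
Qed.

Lemma pos_def00 n (A : 'M[R]_(1 + n)) : pos_def A -> 0 < A 0 0.
Proof.
move=> [_ /(_ (delta_mx 0 0))].
rewrite /sqnorm_mx trmx_delta -rowE -colE !mxE; apply.
by apply/eqP => /matrixP/(_ 0 0)/eqP; rewrite !mxE !eqxx oner_eq0.
Qed.

Lemma pos_def_schur n (A : 'M[R]_(1 + n)) : pos_def A -> pos_def (schur n A).
Proof.
move=> pA; have a0 := pos_def00 _ _ pA; have [sA pA'] := pA; split.
  rewrite /schur linearB/= linearZ/= trmx_mul trmxK; congr (_ - _).
  by rewrite trmx_drsub sA.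
(* This [s] makes the completed square vanish, so the Schur form at [u] is the value of [A] at a
   nonzero vector. *)
move=> u u0; pose s := - ((A 0 0)^-1 * (ursubmx A *m u) 0 0).
have := sqnorm_mx_schur _ _ s u sA (lt0r_neq0 a0).
rewrite /s addNr expr0n/= mulr0 add0r => <-; apply: pA'.
by apply: contra u0; rewrite col_mx_eq0 => /andP[].
Qed.

Lemma pos_def_det_gt0 n (A : 'M[R]_n) : pos_def A -> 0 < \det A.
Proof.
elim: n A => [|n IH] A pA; first by rewrite det_mx00.
have a0 := pos_def00 _ _ pA.
rewrite (det_schur n A pA.1 (lt0r_neq0 a0)) mulr_gt0// IH//.
exact: pos_def_schur.
Qed.

Lemma pos_def_unit n (A : 'M[R]_n) : pos_def A -> A \in unitmx.
Proof. by move=> /pos_def_det_gt0 dA; rewrite unitmxE unitfE gt_eqF. Qed.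

Lemma pos_defZ n (A : 'M[R]_n) c : 0 < c -> pos_def A -> pos_def (c *: A).
Proof.
move=> c0 [sA pA]; split=> [|v v0]; first by rewrite linearZ/= sA.
by rewrite sqnorm_mxZ mulr_gt0// pA.
Qed.

(** Expanding around the minimiser $A^{-1}b$, the cross term is exactly $-2v^\top b$ and the
    constant term is $b^\top A^{-1}b$. *)
Lemma complete_square n (A : 'M[R]_n) v b : A^T = A -> A \in unitmx ->
  sqnorm_mx A v - 2 * (v^T *m b) 0 0 =
  sqnorm_mx A (v - invmx A *m b) - sqnorm_mx (invmx A) b.
Proof.
move=> sA uA; rewrite sqnorm_mxD//.
have -> : sqnorm_mx A (- (invmx A *m b)) = sqnorm_mx (invmx A) b.
  rewrite /sqnorm_mx -mulmxN !linearN/= trmx_mul trmx_inv sA !(mulNmx, mulmxN).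
  by rewrite opprK mulmxA mulmxKV.
by rewrite mulmxN mulmxA mulmxK// entry_oppmx mulrN addrK.
Qed.

End quadratic_forms.

(** * Total mass of a multivariate Gaussian density *)

Section gaussian_integral.
Context {R : realType}.

(** The precision [A] is the convenient parameter: marginalising a coordinate acts on it by a Schur
    complement. *)
Lemma gaussian_pdf_precision n (A : 'M[R]_n) a v : pos_def A ->
  gaussian_pdf a (invmx A) v =
  Num.sqrt (\det A / (2 * pi) ^+ n) * expR (- sqnorm_mx A (v - a) / 2).
Proof.
move=> pA; rewrite /gaussian_pdf invmxK detZ det_inv; congr (_ * _).
rewrite -sqrtrV ?invf_div// divr_ge0 ?exprn_ge0 ?mulr_ge0 ?pi_ge0//.
by rewrite ltW// pos_def_det_gt0.
Qed.

Lemma gaussian_pdf_ge0 n (S : 'M[R]_n) a v : 0 <= gaussian_pdf a S v.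
Proof. by rewrite mulr_ge0 ?expR_ge0 ?invr_ge0 ?sqrtr_ge0. Qed.

(** Chain rule for densities: the first factor is the conditional law of the first coordinate given
    the others, of variance $1/A_{00}$, and the second is the marginal law of the others. *)
Lemma gaussian_pdf_schur n (A : 'M[R]_(1 + n)) a (s : R) u : pos_def A ->
  gaussian_pdf a (invmx A) (col_mx s%:M u) =
  normal_pdf (a 0 0 - (A 0 0)^-1 * (ursubmx A *m (u - dsubmx a)) 0 0)
             (Num.sqrt (A 0 0))^-1 s *
  gaussian_pdf (dsubmx a) (invmx (schur _ A)) u.
Proof.
move=> pA; have a0 := pos_def00 _ _ pA; have [sA _] := pA.
have pS := pos_def_schur _ _ pA; have dS := pos_def_det_gt0 _ _ pS.
rewrite !gaussian_pdf_precision//.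
rewrite normal_pdfE ?invr_eq0 ?sqrtr_eq0 -?ltNge//.
have -> : col_mx s%:M u - a = col_mx (s - a 0 0)%:M (u - dsubmx a).
  rewrite -{1}(vsubmxK a) opp_col_mx add_col_mx; congr col_mx.
  apply/matrixP => i j; rewrite !ord1 !mxE eqxx !mulr1n.
  by congr (_ - a _ _); exact: val_inj.
rewrite sqnorm_mx_schur ?gt_eqF// det_schur ?gt_eqF//.
rewrite /normal_peak /normal_fun exprVn sqr_sqrtr ?(ltW a0)//.
move: (sqnorm_mx _ _) ((ursubmx A *m _) 0 0) dS (A 0 0) a0 => q p dS al al0.
have pi0 : 0 < pi :> R by exact: pi_gt0.
rewrite mulrACA -expRD; congr (_ * expR _); last by field; rewrite gt_eqF.
(* Nonnegativity allows the two normalizers to be merged under one square root. *)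
have v0 : 0 <= (al^-1 * pi) *+ 2 :> R.
  by rewrite mulrn_wge0// mulr_ge0 ?invr_ge0 ?ltW.
rewrite -sqrtrV// -sqrtrM ?invr_ge0//.
congr Num.sqrt; move: (pi : R) pi0 => c c0; rewrite exprS; field.
by rewrite !gt_eqF ?exprn_gt0 ?mulr_gt0.
Qed.

Lemma col_of_tuple_cons n (s : measurableTypeR R)
    (u : n.-tuple (measurableTypeR R)) :
  col_of_tuple (tuple_cons (s, u)) =
  col_mx s%:M (col_of_tuple u) :> 'cV[R]_(1 + n).
Proof.
apply/matrixP => i j; rewrite [j]ord1 !mxE; case: splitP => i' ii'.
  have -> : i = ord0 by apply/val_inj; rewrite /= ii' ord1.
  by rewrite (ord1 i') !mxE eqxx mulr1n.
by rewrite !mxE !(tnth_nth s) ii'.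
Qed.

Lemma measurable_mulmx_entry d (T : measurableType d) m n p
    (F : T -> 'M[R]_(m, n)) (G : T -> 'M[R]_(n, p)) :
  (forall i j, measurable_fun setT (fun t => F t i j)) ->
  (forall i j, measurable_fun setT (fun t => G t i j)) ->
  forall i j, measurable_fun setT (fun t => (F t *m G t) i j).
Proof.
move=> mF mG i j; under eq_fun do rewrite mxE.
by apply: measurable_sum => h; exact: measurable_funM.
Qed.

Lemma measurable_gaussian_pdf n (S : 'M[R]_n) a :
  measurable_fun setT (fun t => gaussian_pdf a S (@col_of_tuple R n t)).
Proof.
apply: measurable_funM => //; apply: measurableT_comp => //.
apply: measurable_funM => //; apply: measurableT_comp => //.
have mv i j : measurable_fun setT (fun t => (@col_of_tuple R n t - a) i j).
  under eq_fun do rewrite !mxE.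
  by apply: measurable_funB => //; exact: measurable_tnth.
apply: measurable_mulmx_entry => // i j.
apply: measurable_mulmx_entry => // {}i {}j.
by under eq_fun do rewrite mxE; exact: mv.
Qed.

Lemma integral_gaussian_pdf n (A : 'M[R]_n) a : pos_def A ->
  (\int[lebesgue_tuple R n]_t
    (gaussian_pdf a (invmx A) (col_of_tuple t))%:E = 1)%E.
Proof.
elim: n A a => [|n IH] A a pA.
  (* In dimension 0 the measure is a Dirac mass and the density is 1, the determinant and the
     exponent being trivial. *)
  rewrite integral_dirac//; last first.
    by apply/measurable_EFinP; exact: measurable_gaussian_pdf.
  rewrite diracT mul1e gaussian_pdf_precision//.
  rewrite det_mx00 expr0 divr1 sqrtr1 mul1r /sqnorm_mx [X in (X *m A)]thinmx0.
  by rewrite !mul0mx mxE oppr0 mul0r expR0.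
have mg := measurable_gaussian_pdf _ (invmx A) a.
(* The measure in dimension n+1 is an image measure, so the integral moves to the product space. *)
have /= -> := @ge0_integral_pushforward _ _ _ _ R _ (@measurable_tuple_cons R n)
  (@lebesgue_measure R \x lebesgue_tuple R n)%E setT
  (fun t => (gaussian_pdf a (invmx A) (col_of_tuple t))%:E) measurableT.
(* This order puts the first coordinate in the inner integral, where the conditional normal density
   integrates to 1. *)
- rewrite preimage_setT fubini_tonelli2//.
  + rewrite -(IH _ (dsubmx (a : 'cV_(1 + n))) (pos_def_schur _ _ pA)).
    apply: eq_integral => u _; rewrite /fubini_G.
    under eq_integral => s _.
      rewrite /= (col_of_tuple_cons n s u) gaussian_pdf_schur//.
      rewrite EFinM muleC.
      over.
    rewrite /= ge0_integralZl//.
    * by rewrite integral_normal_pdf mule1.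
    * by apply/measurable_EFinP; exact: measurable_normal_pdf.
    * by move=> s _; rewrite lee_fin normal_pdf_ge0.
    * by rewrite lee_fin gaussian_pdf_ge0.
  + apply/measurable_EFinP; apply: measurableT_comp mg _.
    exact: measurable_tuple_cons.
  + by move=> z; rewrite lee_fin gaussian_pdf_ge0.
- by apply/measurable_EFinP.
- by move=> z _; rewrite lee_fin gaussian_pdf_ge0.
Qed.

End gaussian_integral.

(** * Gaussian mixtures and conjugate updating *)

Section gaussian_conjugacy.
Context {R : realType}.

(** All terms are nonnegative, so sum and integral commute and Tonelli splits each term into two
    integrals equal to 1. *)
Lemma Rintegral_gaussian_mixture d M (c : 'I_M -> R) (a b : 'I_M -> 'cV[R]_d)
    (P Q : 'M[R]_d) :
  (forall m, 0 <= c m) -> pos_def P -> pos_def Q ->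
  \int[(lebesgue_tuple R d \x lebesgue_tuple R d)%E]_t
    (\sum_(m < M) c m * gaussian_pdf (a m) (invmx P) (col_of_tuple t.1)
                      * gaussian_pdf (b m) (invmx Q) (col_of_tuple t.2))
  = \sum_(m < M) c m.
Proof.
move=> c0 pP pQ; rewrite /Rintegral.
under eq_integral do rewrite -sumEFin.
have mF m : measurable_fun setT
    (fun t => gaussian_pdf (a m) (invmx P) (@col_of_tuple R d t.1) *
              gaussian_pdf (b m) (invmx Q) (@col_of_tuple R d t.2)).
  apply: measurable_funM.
    exact: measurableT_comp (measurable_gaussian_pdf _ _ _) measurable_fst.
  exact: measurableT_comp (measurable_gaussian_pdf _ _ _) measurable_snd.
have g0 := @gaussian_pdf_ge0 R d.
rewrite ge0_integral_sum//; last 2 first.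
- move=> m; apply/measurable_EFinP.
  by under eq_fun do rewrite -mulrA; exact: measurable_funM.
- by move=> m z _; rewrite lee_fin !mulr_ge0.
rewrite (eq_bigr (fun m => (c m)%:E)) ?sumEFin// => m _.
under eq_integral do rewrite -mulrA EFinM.
rewrite ge0_integralZl//; last 3 first.
- exact/measurable_EFinP.
- by move=> z _; rewrite lee_fin mulr_ge0.
- by rewrite lee_fin.
rewrite fubini_tonelli1//; last 2 first.
- exact/measurable_EFinP.
- by move=> z; rewrite lee_fin mulr_ge0.
rewrite -[RHS]mule1 -(integral_gaussian_pdf _ _ (a m) pP); congr (_ * _)%E.
apply: eq_integral => u _; rewrite /fubini_F/=.
under eq_integral do rewrite EFinM.
rewrite ge0_integralZl//; last 3 first.
- by apply/measurable_EFinP; exact: measurable_gaussian_pdf.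
- by move=> z _; rewrite lee_fin.
- by rewrite lee_fin.
by rewrite integral_gaussian_pdf// mule1.
Qed.

Lemma pos_def1 n : pos_def (1%:M : 'M[R]_n).
Proof. by split=> [|v v0]; rewrite ?trmx1// sqnorm_mx1 sqnorm_gt0. Qed.

Lemma pos_def_1D n (B : 'M[R]_n) : B^T = B -> (forall v, 0 <= sqnorm_mx B v) ->
  pos_def (1%:M + B).
Proof.
move=> sB B0; split=> [|v v0]; first by rewrite linearD/= trmx1 sB.
by rewrite sqnorm_mxDl ltr_wpDr// sqnorm_mx1 sqnorm_gt0.
Qed.

(** Puts the posterior covariances in the inverse-of-a-precision form that the integral lemmas
    expect. *)
Lemma scale_invmx n (A : 'M[R]_n) s : 0 < s -> pos_def A ->
  s *: invmx A = invmx (s^-1 *: A).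
Proof.
move=> s0 pA; rewrite invmxZ ?invrK// pos_def_unit//.
by apply: pos_defZ => //; rewrite invr_gt0.
Qed.

Lemma scalar_mx_invmx n (s : R) : s%:M = s *: invmx (1%:M : 'M[R]_n).
Proof. by rewrite invmx1 scalemx1. Qed.

Lemma gaussian_pdf_scaled n (A : 'M[R]_n) a s v : 0 < s -> pos_def A ->
  gaussian_pdf a (s *: invmx A) v =
  Num.sqrt (\det (s^-1 *: A) / (2 * pi) ^+ n) *
  expR (- sqnorm_mx A (v - a) / (2 * s)).
Proof.
move=> s0 pA; rewrite scale_invmx// gaussian_pdf_precision; last first.
  by apply: pos_defZ => //; rewrite invr_gt0.
by rewrite sqnorm_mxZ; congr (_ * expR _); field; rewrite gt_eqF.
Qed.

Lemma gaussian_normalizer_gt0 n (A : 'M[R]_n) s : 0 < s -> pos_def A ->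
  0 < Num.sqrt (\det (s^-1 *: A) / (2 * pi) ^+ n).
Proof.
move=> s0 pA; rewrite sqrtr_gt0 divr_gt0 ?exprn_gt0 ?mulr_gt0 ?pi_gt0//.
by rewrite pos_def_det_gt0//; apply: pos_defZ => //; rewrite invr_gt0.
Qed.

(** An unnormalized Gaussian factor in natural parameters: [B] is the precision and [b] the linear
    term, both in units of $1/s$. At a fixed [s], multiplying factors adds parameters. *)
Definition quad_exp {n} (s : R) (B : 'M[R]_n) (b v : 'cV[R]_n) :=
  expR (- (sqnorm_mx B v - 2 * (v^T *m b) 0 0) / (2 * s)).

Lemma prod_quad_exp n N s (B : 'I_N -> 'M[R]_n) b v :
  \prod_(i < N) quad_exp s (B i) (b i) v =
  quad_exp s (\sum_(i < N) B i) (\sum_(i < N) b i) v.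
Proof.
rewrite /quad_exp -expR_sum; congr expR.
elim/big_rec3: _ => [|i B' b' q _ ->].
  by rewrite /sqnorm_mx mulmx0 mul0mx mulmx0 mxE; ring.
by rewrite sqnorm_mxDl mulmxDr entry_addmx; ring.
Qed.

(** The order of quantifiers matters: [K], the ratio of the two normalizers, precedes the prior mean
    [a], so one constant serves every mixture component. *)
Lemma gaussian_conjugate n (s : R) (B : 'M[R]_n) b :
  0 < s -> pos_def (1%:M + B) ->
  exists2 K : R, 0 < K & forall a v,
    gaussian_pdf a s%:M v * quad_exp s B b v =
    K * (expR (- (sqnorm a - sqnorm_mx (invmx (1%:M + B)) (a + b)) / (2 * s)) *
         gaussian_pdf (invmx (1%:M + B) *m (a + b)) (s *: invmx (1%:M + B)) v).
Proof.
move=> s0; set A := 1%:M + B => pA.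
have N1 := gaussian_normalizer_gt0 _ _ _ s0 (pos_def1 n).
have NA := gaussian_normalizer_gt0 _ _ _ s0 pA.
exists (Num.sqrt (\det (s^-1 *: (1%:M : 'M[R]_n)) / (2 * pi) ^+ n) /
        Num.sqrt (\det (s^-1 *: A) / (2 * pi) ^+ n)).
  exact: divr_gt0.
move=> a v; rewrite scalar_mx_invmx.
rewrite !gaussian_pdf_scaled//; last exact: pos_def1.
move: (Num.sqrt _) N1 => N1 N10; move: (Num.sqrt _) NA => NA NA0.
have cancelNA e f : N1 / NA * (e * (NA * f)) = N1 * (e * f).
  by field; rewrite gt_eqF.
rewrite cancelNA -mulrA -!expRD.
congr (_ * expR _).
(* Prior and factor exponents combine to $\|v\|_A^2-2v^\top(a+b)+\|a\|^2$, up to the common factor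
   $-1/(2s)$. *)
have := complete_square _ _ v (a + b) pA.1 (pos_def_unit _ _ pA).
rewrite (sqnorm_mxD _ 1%:M) ?trmx1// [sqnorm_mx A v]sqnorm_mxDl !sqnorm_mx1.
rewrite sqnormN.
rewrite mulmx1 mulmxN entry_oppmx mulmxDr entry_addmx.
move/eqP; rewrite eq_sym subr_eq => /eqP ->.
by rewrite /quad_exp; field; rewrite gt_eqF.
Qed.

(** Here the density is read as a function of its mean; the term in $\|x\|^2$ goes into [K]. The
    free scale [t] will be the prior variance, whence the ratio [t / s]. *)
Lemma gaussian_likelihood d (x : 'cV[R]_d) (s t : R) : 0 < s -> 0 < t ->
  exists2 K : R, 0 < K & forall mu,
    gaussian_pdf mu s%:M x = K * quad_exp t ((t / s) *: 1%:M) ((t / s) *: x) mu.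
Proof.
move=> s0 t0.
exists (Num.sqrt (\det (s^-1 *: (1%:M : 'M[R]_d)) / (2 * pi) ^+ d) *
        expR (- sqnorm x / (2 * s))).
  by rewrite mulr_gt0 ?expR_gt0 ?gaussian_normalizer_gt0//; exact: pos_def1.
move=> mu; rewrite scalar_mx_invmx.
rewrite gaussian_pdf_scaled//; last exact: pos_def1.
rewrite -mulrA; congr (_ * _); rewrite -expRD; congr expR.
rewrite sqnorm_mxZ -scalemxAr !sqnorm_mx1.
rewrite entry_scalemx addrC -sqnorm_mx1 sqnorm_mxD ?trmx1// !sqnorm_mx1.
rewrite sqnormN.
rewrite mulmx1 [(- mu)^T]linearN/= mulNmx entry_oppmx.
by field; rewrite !gt_eqF.
Qed.

(** The square $(w^\top x)^2$ is the rank-one form $xx^\top$ at [w], and $y^2$ goes into [K]. *)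
Lemma normal_likelihood d (x : 'cV[R]_d) (s t y : R) : 0 < s -> 0 < t ->
  exists2 K : R, 0 < K & forall w,
    normal_pdf ((w^T *m x) 0 0) s y =
    K * quad_exp t ((t / s ^+ 2) *: (x *m x^T)) ((t / s ^+ 2) *: (y *: x)) w.
Proof.
move=> s0 t0; exists (normal_peak s * expR (- y ^+ 2 / (2 * s ^+ 2))).
  by rewrite mulr_gt0 ?expR_gt0// normal_peak_gt0// gt_eqF.
move=> w; rewrite normal_pdfE ?gt_eqF// /normal_fun -mulrA; congr (_ * _).
rewrite -expRD; congr expR; rewrite sqnorm_mxZ.
have -> : sqnorm_mx (x *m x^T) w = (w^T *m x) 0 0 ^+ 2.
  have -> : sqnorm_mx (x *m x^T) w = ((w^T *m x) *m (w^T *m x)^T) 0 0.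
    by rewrite /sqnorm_mx trmx_mul trmxK !mulmxA.
  by rewrite {1}mxE big_ord1 [_^T _ _]mxE expr2.
rewrite -!scalemxAr !entry_scalemx.
by field; rewrite !gt_eqF.
Qed.

Lemma prod_quad_exp_multiple n N (t : R) (f : 'I_N -> 'cV[R]_n -> R)
    (B : 'I_N -> 'M[R]_n) b :
  (forall i, exists2 K : R, 0 < K &
    forall v, f i v = K * quad_exp t (B i) (b i) v) ->
  exists2 K : R, 0 < K & forall v, \prod_(i < N) f i v =
    K * quad_exp t (\sum_(i < N) B i) (\sum_(i < N) b i) v.
Proof.
(* One constant per index is selected by choice, so that their product can be formed. *)
move=> fE; pose K i := s2val (cid2 (fE i)).
exists (\prod_(i < N) K i).
  by apply: prodr_gt0 => i _; exact: s2valP (cid2 (fE i)).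
move=> v; rewrite -prod_quad_exp -big_split/=; apply: eq_bigr => i _.
exact: s2valP' (cid2 (fE i)) v.
Qed.

End gaussian_conjugacy.

(** * The posterior of the pretraining model *)

Theorem lemma4p1 (R : realType) (d M : nat) (hd : (1 <= d)%N) (hM : (1 <= M)%N)
  (smu sw sx sy : R)
  (hsmu : 0 < smu) (hsw : 0 < sw) (hsx : 0 < sx) (hsy : 0 < sy)
  (wt : 'I_M -> R) (mu_ w_ : 'I_M -> 'cV[R]_d)
  (hwt : forall m, 0 < wt m < 1) (hwt1 : \sum_(m < M) wt m = 1)
  (hmu_ : forall m, l2norm (mu_ m) = 1) (hw_ : forall m, l2norm (w_ m) = 1)
  (r : R) (hr : 1 < r) (hratio : forall a b, 1 / r <= wt a / wt b <= r)
  (k : nat) (x : 'I_k.+1 -> 'cV[R]_d) (y : 'I_k -> R) :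
  let dmu := smu ^+ 2 / sx ^+ 2 in
  let dw := sw ^+ 2 / sy ^+ 2 in
  let Smu_bar : 'M[R]_d := 1%:M in
  let mu_bar : 'cV[R]_d := (k.+1%:R)^-1 *: \sum_(i < k.+1) x i in
  let Sw_bar : 'M[R]_d :=
    (k%:R)^-1 *: \sum_(i < k) (labeled x i *m (labeled x i)^T) in
  let w_bar : 'cV[R]_d := (k%:R)^-1 *: \sum_(i < k) (y i *: labeled x i) in
  let Amu : 'M[R]_d := invmx (1%:M + (k.+1%:R * dmu) *: Smu_bar) in
  let Aw : 'M[R]_d := invmx (1%:M + (k%:R * dw) *: Sw_bar) in
  let mu_t m := Amu *m (mu_ m + (k.+1%:R * dmu) *: mu_bar) in
  let w_t m := Aw *m (w_ m + (k%:R * dw) *: w_bar) in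
  let Smu_t := smu ^+ 2 *: Amu in
  let Sw_t := sw ^+ 2 *: Aw in
  let cmu m := expR (- (sqnorm (mu_ m)
    - sqnorm_mx Amu (mu_ m + (k.+1%:R * dmu) *: mu_bar)) / (2 * smu ^+ 2)) in
  let cw m := expR (- (sqnorm (w_ m)
    - sqnorm_mx Aw (w_ m + (k%:R * dw) *: w_bar)) / (2 * sw ^+ 2)) in
  exists C1 : R,
    let wt_t m := wt m * C1 * cmu m * cw m in
    \sum_(m < M) wt_t m = 1 /\
    forall mu w : 'cV[R]_d,
      posterior_pdf wt mu_ w_ smu sw sx sy x y mu w =
      \sum_(m < M) wt_t m * gaussian_pdf (mu_t m) Smu_t mu
                          * gaussian_pdf (w_t m) Sw_t w.
Proof.
move=> dmu dw Smu_bar mu_bar Sw_bar w_bar Amu Aw mu_t w_t Smu_t Sw_t cmu cw.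
have smu2 : 0 < smu ^+ 2 by rewrite exprn_gt0.
have sw2 : 0 < sw ^+ 2 by rewrite exprn_gt0.
have sx2 : 0 < sx ^+ 2 by rewrite exprn_gt0.
(* The scales are the prior variances, which produces [dmu] and [dw]; there are k+1 factors in [mu]
   but only k in [w]. *)
have [Kx Kx0 xE] := prod_quad_exp_multiple _ _ _ _ _ _
  (fun i => gaussian_likelihood _ (x i) _ _ sx2 smu2).
have [Ky Ky0 yE] := prod_quad_exp_multiple _ _ _ _ _ _
  (fun i => normal_likelihood _ (labeled x i) _ _ (y i) hsy sw2).
rewrite sumr_const card_ord -scaler_sumr -/dmu in xE.
rewrite -!scaler_sumr -/dw in yE.
have SmuE : (dmu *: 1%:M) *+ k.+1 = (k.+1%:R * dmu) *: Smu_bar.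
  by rewrite -scalerA -scaler_nat.
have muE : dmu *: \sum_i x i = (k.+1%:R * dmu) *: mu_bar.
  by rewrite /mu_bar scalerA mulrAC divff ?mul1r ?pnatr_eq0.
(* For [k = 0] the sum is empty, so the junk value [0^-1 = 0] is harmless. *)
have scale0 (V : lmodType R) (F : 'I_k -> V) :
    dw *: \sum_i F i = (k%:R * dw) *: (k%:R^-1 *: \sum_i F i).
  rewrite scalerA mulrAC; have [k0|k0] := eqVneq k 0%N.
    by rewrite big1 ?scaler0// => i; have := ltn_ord i; rewrite {2}k0.
  by rewrite divff ?mul1r ?pnatr_eq0.
rewrite SmuE muE in xE; rewrite !scale0 -/Sw_bar -/w_bar in yE.
set Bmu := _ *: Smu_bar in Amu mu_t Smu_t cmu xE *.
set Bw := _ *: Sw_bar in Aw w_t Sw_t cw yE *.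
have pmu : pos_def (1%:M + Bmu).
  apply: pos_def_1D => [|v]; first by rewrite linearZ/= trmx1.
  rewrite sqnorm_mxZ sqnorm_mx1 sqnormE mulr_ge0 ?sumr_ge0//.
    by rewrite mulr_ge0// divr_ge0// ltW.
  by move=> i _; exact: sqr_ge0.
have pw : pos_def (1%:M + Bw).
  (* Back to the plain sum, whose scalar [dw] is nonnegative without a case split on [k]. *)
  rewrite /Bw /Sw_bar -scale0.
  apply: pos_def_1D => [|v].
    rewrite linearZ/= linear_sum/=; congr (_ *: _).
    by apply: eq_bigr => i _; rewrite trmx_mul trmxK.
  rewrite sqnorm_mxZ mulr_ge0 ?divr_ge0 ?(ltW sw2) ?sqr_ge0//.
  rewrite /sqnorm_mx mulmx_sumr mulmx_suml summxE sumr_ge0// => i _.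
  (* Each summand is the square of the scalar $x_i^\top v$. *)
  have -> : v^T *m (labeled x i *m (labeled x i)^T) *m v =
     ((labeled x i)^T *m v)^T *m ((labeled x i)^T *m v).
    by rewrite trmx_mul trmxK !mulmxA.
  by rewrite -/(sqnorm _) sqnormE sumr_ge0// => j _; exact: sqr_ge0.
pose bmu := (k.+1%:R * dmu) *: mu_bar; pose bw := (k%:R * dw) *: w_bar.
have [Kmu Kmu0 muK] := gaussian_conjugate _ _ _ bmu smu2 pmu.
have [Kw Kw0 wK] := gaussian_conjugate _ _ _ bw sw2 pw.
pose K := Kx * Ky * Kmu * Kw.
have K0 : 0 < K by rewrite !mulr_gt0.
have jointE mu w : joint_pdf wt mu_ w_ smu sw sx sy x y mu w =
    \sum_(m < M) K * (wt m * cmu m * cw m) * gaussian_pdf (mu_t m) Smu_t mu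
                                          * gaussian_pdf (w_t m) Sw_t w.
  rewrite /joint_pdf /prior_pdf /likelihood big_split/= mulrAC.
  (* The unlabelled input informs [mu] only and joins the k labelled ones. *)
  have -> : (\prod_(i < k) gaussian_pdf mu (sx ^+ 2)%:M (labeled x i)) *
      gaussian_pdf mu (sx ^+ 2)%:M (x ord_max) =
      \prod_(i < k.+1) gaussian_pdf mu (sx ^+ 2)%:M (x i).
    by rewrite big_ord_recr.
  rewrite xE yE mulr_suml; apply: eq_bigr => m _.
  transitivity (wt m * Kx * Ky *
    (gaussian_pdf (mu_ m) (smu ^+ 2)%:M mu * quad_exp (smu ^+ 2) Bmu bmu mu) *
    (gaussian_pdf (w_ m) (sw ^+ 2)%:M w * quad_exp (sw ^+ 2) Bw bw w)).
    by ring.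
  rewrite muK wK -/(cmu m) -/(cw m) -/(mu_t m) -/(w_t m) /K.
  move: (cmu m) (cw m) (gaussian_pdf _ _ mu) (gaussian_pdf _ _ w) => e f g h.
  by clear; ring.
have c0 m : 0 < wt m * cmu m * cw m.
  by rewrite !mulr_gt0 ?expR_gt0//; case/andP: (hwt m).
have evE : evidence wt mu_ w_ smu sw sx sy x y =
    K * \sum_(m < M) wt m * cmu m * cw m.
  rewrite /evidence mulr_sumr.
  under eq_Rintegral do rewrite jointE.
  rewrite /Smu_t /Sw_t !scale_invmx//.
  apply: Rintegral_gaussian_mixture.
  - by move=> m; rewrite mulr_ge0// ltW.
  - by apply: pos_defZ => //; rewrite invr_gt0.
  - by apply: pos_defZ => //; rewrite invr_gt0.
have Z0 : 0 < \sum_(m < M) wt m * cmu m * cw m.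
  (* As [M] is at least 1, a positive term can be split off. *)
  rewrite (bigD1 (Ordinal hM))//= ltr_pwDl// sumr_ge0// => m _.
  exact/ltW.
exists (\sum_(m < M) wt m * cmu m * cw m)^-1 => wt_t; split.
  rewrite -[RHS](divff (lt0r_neq0 Z0)) mulrC mulr_sumr.
  by apply: eq_bigr => m _; rewrite /wt_t; ring.
(* The constant [K] cancels between joint density and evidence, leaving [C1] as the inverse of the
   sum of unnormalized weights. *)
move=> mu w; rewrite /posterior_pdf jointE evE mulr_suml.
apply: eq_bigr => m _; rewrite /wt_t.
move: (cmu m) (cw m) (gaussian_pdf _ _ mu) (gaussian_pdf _ _ w) => e f g h.
move: (\sum_(_ < _) _) (K) Z0 K0 => Z L Z0' L0.
by clear - Z0' L0; field; rewrite !gt_eqF.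
Qed.
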